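(* Let $\alpha=\alpha_0^{p^s}\in\mathcal{T}_2\setminus\{0\}$, where $\alpha_0\in\mathcal{T}_2$ is such that $x^n-\alpha_0$ is irreducible over $\mathcal{R}_2$. Let $\beta\in\mathcal{T}_2\setminus\{0\}$, and let $\mathcal{C}=\langle(x^n-\alpha_0)^\nu\rangle$ be an $(\alpha+\gamma\beta)$-constacyclic code of length $np^s$ over $\mathcal{R}_2$, where $0\le\nu\le2p^s$. For $0\le\rho\le np^s$, let $\mathcal{A}_\rho$ denote the number of codewords in $\mathcal{C}$ having RT weight $\rho$. (a) For $\nu=2p^s$: $\mathcal{A}_\rho=1$ if $\rho=0$, and $\mathcal{A}_\rho=0$ otherwise. (b) For $p^s+1\le\nu\le2p^s-1$: $$\mathcal{A}_\rho=\begin{cases}1&\text{if }\rho=0;\\0&\text{if }1\le\rho\le n\nu-np^s;\\(p^m-1)p^{m(\rho-n\nu+np^s-1)}&\text{if }n\nu-np^s+1\le\rho\le np^s.\end{cases}$$ (c) For $\nu=yp^s$ with $y\in\{0,1\}$: $$\mathcal{A}_\rho=\begin{cases}1&\text{if }\rho=0;\\(p^{m(2-y)}-1)p^{m(2-y)(\rho-1)}&\text{if }1\le\rho\le np^s.\end{cases}$$ (d) For $1\le\nu\le p^s-1$: $$\mathcal{A}_\rho=\begin{cases}1&\text{if }\rho=0;\\(p^m-1)p^{m(\rho-1)}&\text{if }1\le\rho\le n\nu;\\(p^{2m}-1)p^{m(2\rho-n\nu-2)}&\text{if }n\nu+1\le\rho\le np^s.\end{cases}$$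
   Context: $\mathcal{R}_2$ is a finite commutative chain ring with unity, with maximal ideal $\langle\gamma\rangle$, where $\gamma\neq0$ and $\gamma^2=0$; its residue field has order $p^m$, $p$ prime. $\zeta\in\mathcal{R}_2$ has multiplicative order $p^m-1$ and $\mathcal{T}_2=\{0,1,\zeta,\dots,\zeta^{p^m-2}\}$. $n,s$ are positive integers with $\gcd(n,p)=1$. For a unit $\lambda$, $\lambda$-constacyclic codes of length $N$ over $\mathcal{R}_2$ are identified with ideals of $\mathcal{R}_2[x]/\langle x^N-\lambda\rangle$, whose elements are represented by polynomials of degree less than $N$. The Rosenbloom-Tsfasman (RT) weight is $w_{RT}(c(x))=1+\deg c(x)$ if $c(x)\ne0$ and $w_{RT}(0)=0$. *)

(* Defs.v *)
From HB Require Import structures.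
From mathcomp Require Import all_boot all_order all_algebra.
Set Implicit Arguments.
Unset Strict Implicit.
Unset Printing Implicit Defensive.
Import GRing.Theory.
Local Open Scope ring_scope.

(* Joins the library's finite-type and commutative-ring structures on
   {poly %/ h}. *)
HB.instance Definition _ (R : finComNzRingType) (h : {poly R}) :=
  Finite.on {poly %/ h}.

Definition principal_ideal (R : finComNzRingType) (a : R) : {set R} :=
  [set r * a | r in [set: R]].

(* [idealr_closed] only accepts proper ideals; adding the unit ideal, which
   contains every ideal, would not change either of the next two notions. *)
Definition chain_ring (R : finComNzRingType) : Prop :=
  forall I J : {set R}, idealr_closed I -> idealr_closed J ->
    (I \subset J) || (J \subset I).

Definition maximal_ideal (R : finComNzRingType) (M : {set R}) : Prop :=
  idealr_closed M /\
  forall I : {set R}, idealr_closed I -> M \subset I -> I = M.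

Definition residue_classes (R : finComNzRingType) (I : {set R}) : {set {set R}} :=
  [set [set x + y | y in I] | x in [set: R]].

Definition teichmuller (R : finComNzRingType) (zeta : R) (q : nat) : {set R} :=
  0 |: [set zeta ^+ i | i : 'I_q.-1].

Definition invertible (A : comNzRingType) (a : A) : Prop :=
  exists b : A, a * b = 1.

(* Irreducibility in A[x] for an arbitrary commutative ring A: the library's
   [irreducible_poly] and its unit structure on {poly A} need A to be an
   integral domain. *)
Definition irreducible_over (A : comNzRingType) (f : {poly A}) : Prop :=
  [/\ f != 0, ~ invertible f &
      forall g h : {poly A}, f = g * h -> invertible g \/ invertible h].

(* A[x]/<x^N - lambda>, whose elements are the polynomials of degree < N.
   For N = 0 this would be a junk value: {poly %/ h} is A[x]/<h> only when h is
   monic and nonconstant. *)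
Notation constacyclic_ring N lambda := {poly %/ ('X^N - lambda%:P)}.

(* [size c] is 1 + deg c for c != 0, and 0 for c = 0. *)
Definition rt_weight (A : comNzRingType) (N : nat) (lambda : A)
    (c : constacyclic_ring N lambda) : nat :=
  size (c : {poly A}).

Definition rt_number (R : finComNzRingType) (N : nat) (lambda : R)
    (C : {set constacyclic_ring N lambda}) (rho : nat) : nat :=
  #|[set c in C | rt_weight c == rho]|.

(* Main.v *)
Require Import Defs.
From HB Require Import structures.
From mathcomp Require Import all_boot all_order all_algebra.
From mathcomp Require Import ring zify.
Set Implicit Arguments.
Unset Strict Implicit.
Unset Printing Implicit Defensive.
Import GRing.Theory.
Local Open Scope ring_scope.

(** Write q = p^m, P = p^s, N = n P, f = 'X^n - alpha0, and F for the class of f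
modulo 'X^N - lambda, where lambda = alpha + gamma beta.

The weights are counted one degree at a time. Let C_r be the additive group of
codewords of size at most r. Reading off the coefficient of 'X^r is additive on
C_(r+1) with kernel C_r, so |C_(r+1)| = |L_r| |C_r| with L_r the set of values
that occur ([card_words_leS]), and the number of codewords of weight r+1 is
(|L_r| - 1) |C_r| ([rt_numberS]). Everything is thus reduced to the sets L_i,
i < N, which take only three values ([card_leading_coefs]):
  - L_i = R when n nu <= i;
  - L_i = gamma R when n (nu - P) <= i < n nu, with truncated subtraction;
  - L_i = 0 when i < n (nu - P).
As |gamma R| = q and |R| = q^2, this gives |L_i| = q^e with e the number of
true conditions among n nu <= i and n (nu - P) <= i, hence the closed form of
|C_r| in [card_words_le]. The four cases of the theorem are its instances.

What ties the code to gamma is that F^P = gamma u with u invertible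
([expr_pexp_unit_mul]): as p divides the inner binomial coefficients and lies
in gamma R, expanding 'X^N = (F + alpha0)^P gives F^P = gamma (beta - F w), and
F is nilpotent while beta is invertible. In particular F^(2P) = 0.

The lower bounds on L_i come from the monic word F^nu and from
gamma F^(nu - P), which lies in the ideal generated by F^nu. The upper bounds
come from annihilators: if c is in the code then F^(2P - nu) c = 0 and
gamma F^(P - nu) c = 0. When c is short these products have degree less than N,
so they vanish as polynomials, and the monic factor can be cancelled, leaving
c = 0 or gamma c = 0 ([annihilated_short_eq0]). *)

(** * Additive maps, maximal ideals and nilpotent elements *)

(** The fibres of f on A are the translates of its kernel in A. *)
Lemma card_additive_image (U V : finZmodType) (f : U -> V) (A : {set U}) :
  zmod_closed A -> {morph f : x y / x - y} ->
  #|A| = (#|f @: A| * #|[set x in A | f x == 0%R]|)%N.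
Proof.
move=> [A0 AB] fB; rewrite -sum1_card (partition_big_imset f) /=.
rewrite -sum_nat_const; apply: eq_bigr => _ /imsetP[x Ax ->].
have f0 : f 0 = 0 by rewrite -(subrr 0) fB subrr.
rewrite sum1dep_card -[RHS](card_imset _ (addrI x)).
apply: eq_card => y; rewrite inE; apply/andP/imsetP => [[Ay /eqP fy]|[z]].
  exists (y - x); last by rewrite addrC subrK.
  by rewrite inE AB //= fB fy subrr.
rewrite inE => /andP[Az /eqP fz] ->.
have -> : x + z = x - (0 - z) by rewrite sub0r opprK.
by rewrite AB ?AB // !fB fz f0 !subr0.
Qed.

Lemma mem_principal_ideal (R : finComNzRingType) (a x : R) :
  reflect (exists r, x = r * a) (x \in principal_ideal a).
Proof.
apply: (iffP imsetP) => [[r _ ->]|[r ->]]; first by exists r.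
by exists r; rewrite ?inE.
Qed.

Lemma principal_ideal_zmod_closed (R : finComNzRingType) (a : R) :
  zmod_closed (principal_ideal a).
Proof.
split; first by apply/mem_principal_ideal; exists 0; rewrite mul0r.
move=> _ _ /mem_principal_ideal[r ->] /mem_principal_ideal[t ->].
by apply/mem_principal_ideal; exists (r - t); rewrite mulrBl.
Qed.

(** [idealr_closed] describes proper ideals only, so maximality of M applies to
M + R x as soon as that ideal does not contain 1. *)
Lemma comaximal_of_notin (R : finComNzRingType) (M : {set R}) (x : R) :
  maximal_ideal M -> x \notin M -> exists2 y, y \in M & exists b, y + b * x = 1.
Proof.
move=> [[M0 M1 MC] Mmax] xM.
pose I := [set u.1 + u.2 * x | u in setX M [set: R]].
have memI y b : y \in M -> y + b * x \in I.
  by move=> My; apply/imsetP; exists (y, b); rewrite // !inE My.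
case I1 : (1 \in I).
  by case/imsetP: I1 => -[y b] /setXP[/= My _] ->; exists y => //; exists b.
have idI : idealr_closed I.
  split; [by rewrite -(add0r 0) -[X in _ + X](mul0r x) memI | by rewrite I1 |].
  move=> a _ _ /imsetP[[y b] /setXP[/= My _] ->]
    /imsetP[[z c] /setXP[/= Mz _] ->].
  by rewrite mulrDr addrACA mulrA -mulrDl memI ?MC.
have MI : M \subset I.
  by apply/subsetP => y My; rewrite -[y]addr0 -(mul0r x) memI.
by rewrite -(Mmax I idI MI) -[x]add0r -[X in _ + X]mul1r memI in xM.
Qed.

Lemma invertible_1subr_nilp (A : comNzRingType) (y : A) k :
  y ^+ k = 0 -> invertible (1 - y).
Proof.
move=> yk; exists (\sum_(i < k) y ^+ i).
by rewrite -opprB mulNr -subrX1 yk sub0r opprK.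
Qed.

Lemma invertibleM (A : comNzRingType) (x y : A) :
  invertible x -> invertible y -> invertible (x * y).
Proof.
by case=> x' xx' [y' yy']; exists (x' * y'); rewrite mulrACA xx' yy' mulr1.
Qed.

Lemma invertible_subr_nilp (A : comNzRingType) (b y : A) k :
  invertible b -> y ^+ k = 0 -> invertible (b - y).
Proof.
move=> b_inv yk; have [b' bb'] := b_inv.
have -> : b - y = b * (1 - b' * y) by rewrite mulrBr mulrA bb' mulr1 mul1r.
apply: invertibleM => //; apply: (@invertible_1subr_nilp _ _ k).
by rewrite exprMn yk mulr0.
Qed.

(** If x were outside M then y + b x = 1 with y in M, and y = 1 - b x would be
invertible because b x is nilpotent. *)
Lemma nilp_in_maximal (R : finComNzRingType) (M : {set R}) (x : R) k :
  maximal_ideal M -> x ^+ k = 0 -> x \in M.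
Proof.
move=> maxM xk; apply/negP => /negP xM.
have [y My [b yb]] := comaximal_of_notin maxM xM.
have [[M0 /negP M1 MC] _] := maxM.
have [z yz] : invertible y.
  have -> : y = 1 - b * x by rewrite -yb addrK.
  by apply: (@invertible_1subr_nilp _ _ k); rewrite exprMn xk mulr0.
by apply: M1; rewrite -yz mulrC -[_ * y]addr0 MC.
Qed.

(** The translation x |-> x + 1 permutes R, and adds |R| to the sum of its
elements. *)
Lemma natr_card_eq0 (R : finPzRingType) : #|R|%:R = 0 :> R.
Proof.
apply: (addrI (\sum_(x : R) x)); rewrite addr0 -sumr_const -big_split /=.
by rewrite [RHS](reindex_inj (addIr 1)).
Qed.

(** Both images are in bijection with the set of pairs (f x, h x). *)
Lemma card_imset_same_kernel (T U V : finType) (f : T -> U) (h : T -> V)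
    (A : {set T}) :
  (forall x y, f x = f y <-> h x = h y) -> #|f @: A| = #|h @: A|.
Proof.
move=> fh; pose k x := (f x, h x).
have -> : f @: A = fst @: (k @: A) by rewrite -imset_comp.
have -> : h @: A = snd @: (k @: A) by rewrite -imset_comp.
transitivity #|k @: A|; [|apply/esym]; apply: card_in_imset.
  by move=> _ _ /imsetP[x _ ->] /imsetP[y _ ->] /= e;
    rewrite /k e (proj1 (fh x y) e).
by move=> _ _ /imsetP[x _ ->] /imsetP[y _ ->] /= e;
    rewrite /k e (proj2 (fh x y) e).
Qed.

(** * A maximal ideal generated by an element of square zero *)

Section SquareZeroMaximal.
Variables (R : finComNzRingType) (g : R).
Hypotheses (max_g : maximal_ideal (principal_ideal g)).
Hypotheses (g_neq0 : g != 0) (g_sq0 : g ^+ 2 = 0).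

(** If x lies outside gR then r g + b x = 1 for some r and b; multiplying by g
gives b g x = g, so x cannot kill the nonzero g. *)
Lemma annihilator_gamma x : (g * x == 0) = (x \in principal_ideal g).
Proof.
apply/eqP/idP => [gx|/mem_principal_ideal[r ->]]; last first.
  by rewrite mulrCA -expr2 g_sq0 mulr0.
apply/negP => /negP xM.
have [_ /mem_principal_ideal[r ->] [b rb]] := comaximal_of_notin max_g xM.
case/eqP: g_neq0; rewrite -[g]mulr1 -rb mulrDr mulrCA -expr2 g_sq0.
by rewrite mulr0 add0r mulrCA gx mulr0.
Qed.

(** The maps x |-> x + gR and x |-> x g identify the same elements, because the
annihilator of g is gR. *)
Lemma card_principal_ideal_gamma :
  #|principal_ideal g| = #|residue_classes (principal_ideal g)|.
Proof.
have [P0 PB] := principal_ideal_zmod_closed g.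
apply/esym/card_imset_same_kernel => x y.
split=> exy.
  apply/eqP; rewrite -subr_eq0 -mulrBl mulrC annihilator_gamma.
  have : x \in [set y + z | z in principal_ideal g].
    by rewrite -exy; apply/imsetP; exists 0; rewrite ?addr0.
  by case/imsetP=> z Pz ->; rewrite addrC addKr.
have Pxy : x - y \in principal_ideal g.
  by rewrite -annihilator_gamma mulrBr subr_eq0 ![g * _]mulrC exy.
have Pyx : y - x \in principal_ideal g by rewrite -opprB -sub0r PB.
apply/setP => z; apply/imsetP/imsetP => -[t Pt ->].
  by exists (t - (y - x)); rewrite 1?PB //; ring.
by exists (t - (x - y)); rewrite 1?PB //; ring.
Qed.

(** Multiplication by g has both its image and its kernel equal to gR. *)
Lemma card_ring_gamma : #|R| = (#|residue_classes (principal_ideal g)| ^ 2)%N.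
Proof.
rewrite -cardsT (@card_additive_image R R ( *%R g) [set: R]); first last.
- exact: mulrBr.
- by split=> [|? ? _ _]; apply: in_setT.
rewrite expnS expn1 -card_principal_ideal_gamma; congr (_ * _)%N.
  by rewrite /principal_ideal (eq_imset _ (mulrC g)).
by apply: eq_card => x; rewrite !inE annihilator_gamma.
Qed.
End SquareZeroMaximal.

(** * The p^s-th power of a sum *)

(** Otherwise p^s would be prime to 'C(p^s, i), and the identity
i 'C(p^s, i) = p^s 'C(p^s - 1, i - 1) would make p^s divide i < p^s. *)
Lemma dvdn_bin_pexp p s i :
  prime p -> (0 < i < p ^ s)%N -> (p %| 'C(p ^ s, i))%N.
Proof.
case: i => // i p_pr /= i_lt; apply: contraLR i_lt => pC.
have co : coprime (p ^ s) 'C(p ^ s, i.+1) by rewrite coprimeXl // prime_coprime.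
rewrite -leqNgt dvdn_leq // -(Gauss_dvdl _ co).
by rewrite -mul_bin_diag dvdn_mulr.
Qed.

(** The error term keeps a factor x besides p: in [expr_pexp_unit_mul], where p is
a multiple of g, it is this factor that is nilpotent once g is taken out. *)
Lemma exprDn_pexp (A : comPzRingType) (x y : A) p s : prime p ->
  exists h, (x + y) ^+ (p ^ s) = x ^+ (p ^ s) + y ^+ (p ^ s) + p%:R * x * h.
Proof.
move=> p_pr; have P_gt0 : (0 < p ^ s)%N by rewrite expn_gt0 prime_gt0.
case EP : (p ^ s)%N P_gt0 => [//|P] _; rewrite addrC exprDn.
rewrite big_ord_recl big_ord_recr /= subnn expr0 mul1r binn.
rewrite subn0 mulr1 !mulr1n.
exists (\sum_(i < P) y ^+ (P - i) * x ^+ i * ('C(P.+1, i.+1) %/ p)%:R).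
rewrite addrA addrC addrA; congr (_ + _).
rewrite mulr_sumr; apply: eq_bigr => i _.
have pC : (p %| 'C(P.+1, i.+1))%N by rewrite -EP dvdn_bin_pexp //= EP ltnS.
rewrite /bump /= add1n -mulr_natr subSS -[in LHS](divnK pC) natrM exprS.
by ring.
Qed.

(** Expanding the left-hand side of the last hypothesis gives
F^(p^s) = g (b - c F h). So F^(2 p^s) is a multiple of g^2 = 0, and b - c F h
differs from the invertible b by a nilpotent element. *)
Lemma expr_pexp_unit_mul (A : comNzRingType) p s (F a g b c : A) :
  prime p -> p%:R = c * g -> g ^+ 2 = 0 -> invertible b ->
  (F + a) ^+ (p ^ s) = a ^+ (p ^ s) + g * b ->
  exists2 u, invertible u & F ^+ (p ^ s) = g * u.
Proof.
move=> p_pr pE g2 b_inv FaE; have [h hE] := exprDn_pexp F a s p_pr.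
have FE : F ^+ (p ^ s) = g * (b - c * F * h).
  apply: (addIr (a ^+ (p ^ s) + p%:R * F * h)).
  by rewrite addrA -hE FaE pE; ring.
exists (b - c * F * h) => //.
apply: (@invertible_subr_nilp _ _ _ (p ^ s * 2)) => //.
by rewrite !exprMn [F ^+ _]exprM FE exprMn g2 mul0r mulr0 mul0r.
Qed.

(** * Counting codewords by their leading coefficient *)

Section Codewords.
Variables (R : finComNzRingType) (N : nat) (lambda : R).
Hypothesis N_gt0 : (0 < N)%N.
Notation Q := (constacyclic_ring N lambda).
Notation inQ := (in_qpoly ('X^N - lambda%:P)).
Implicit Types (C : {set Q}) (c : Q).

Lemma mk_monic_XnsubC : mk_monic ('X^N - lambda%:P) = 'X^N - lambda%:P.
Proof. by rewrite /mk_monic size_XnsubC // monicXnsubC // ltnS N_gt0. Qed.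

Lemma size_codeword c : (size (c : {poly R}) <= N)%N.
Proof.
by have := size_mk_monic c; rewrite [ltnRHS](_ : _ = N.+1) //
  mk_monic_XnsubC size_XnsubC.
Qed.

Lemma in_qpolyK (a : {poly R}) : (size a <= N)%N -> inQ a = a :> {poly R}.
Proof. by move=> sa; rewrite in_qpoly_small // mk_monic_XnsubC size_XnsubC. Qed.

Lemma codewordK c : inQ (c : {poly R}) = c.
Proof. by apply/val_inj; apply: in_qpolyK (size_codeword c). Qed.

Lemma in_qpoly_Xn : inQ 'X^N = inQ lambda%:P.
Proof.
apply/eqP; rewrite -subr_eq0 -raddfB; apply/eqP/val_inj => /=.
by rewrite mk_monic_XnsubC Pdiv.RingMonic.rmodpp // monicXnsubC.
Qed.

Definition words_le C r := [set c in C | (size (c : {poly R}) <= r)%N].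
Definition leading_coefs C r := [set (c : {poly R})`_r | c : Q in words_le C r.+1].

Lemma words_le_zmod_closed C r : zmod_closed C -> zmod_closed (words_le C r).
Proof.
case=> C0 CB; split; first by rewrite inE C0 size_poly0.
move=> c d; rewrite !inE => /andP[Cc sc] /andP[Cd sd]; rewrite CB //=.
by rewrite (leq_trans (size_polyD _ _)) // geq_max size_polyN sc.
Qed.

(** The coefficient of 'X^r is additive on the words of size at most r + 1, and
it vanishes exactly on the words of size at most r. *)
Lemma card_words_leS C r : zmod_closed C ->
  #|words_le C r.+1| = (#|leading_coefs C r| * #|words_le C r|)%N.
Proof.
move=> zC; rewrite (@card_additive_image _ _ (fun c : Q => (c : {poly R})`_r)).
- congr (_ * _)%N; apply: eq_card => c; rewrite !inE -andbA; congr (_ && _).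
  apply/andP/idP => [[sc /eqP cr]|sc]; last first.
    by rewrite (leqW sc) nth_default.
  rewrite leqNgt; apply/negP => rs; have es : size (c : {poly R}) = r.+1 by lia.
  have : lead_coef (c : {poly R}) = 0 by rewrite lead_coefE es.
  by move/eqP; rewrite lead_coef_eq0 -size_poly_eq0 es.
- exact: words_le_zmod_closed.
- by move=> c d; rewrite -coefB.
Qed.

Lemma card_words_le0 C : 0 \in C -> #|words_le C 0| = 1%N.
Proof.
move=> C0; rewrite -(cards1 (0 : Q)); apply: eq_card => c; rewrite !inE.
rewrite size_poly_leq0; apply/andP/eqP => [[_ /eqP c0]|->//].
exact: val_inj.
Qed.

Lemma rt_number0 C : 0 \in C -> rt_number C 0 = 1%N.
Proof.
move=> C0; rewrite -(card_words_le0 C0); apply: eq_card => c.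
by rewrite !inE leqn0.
Qed.

Lemma rt_numberS C r : zmod_closed C ->
  rt_number C r.+1 = ((#|leading_coefs C r| - 1) * #|words_le C r|)%N.
Proof.
move=> zC; rewrite mulnBl mul1n -card_words_leS //.
apply/eqP; rewrite -(eqn_add2r #|words_le C r|) subnK; last first.
  apply/subset_leq_card/subsetP => c; rewrite !inE => /andP[-> sc].
  exact: leqW.
rewrite /rt_number -cardsUI [X in (_ + X)%N]eq_card0 ?addn0 => [|c]; last first.
  rewrite !inE /rt_weight; case: (c \in C) => //=.
  by case: eqP => //= ->; rewrite ltnn.
apply/eqP/eq_card => c; rewrite !inE /rt_weight; case: (c \in C) => //=.
by rewrite [RHS]leq_eqVlt ltnS.
Qed.

(** * Codes generated by a power of a monic polynomial *)

Section PowersOfMonic.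
Variables (f : {poly R}) (n : nat).
Hypotheses (f_monic : f \is monic) (size_f : size f = n.+1).

Lemma monic_pow k : f ^+ k \is monic. Proof. exact: monic_exp. Qed.

Lemma size_monic_pow k : size (f ^+ k) = (n * k).+1.
Proof.
elim: k => [|k IHk]; first by rewrite expr0 size_poly1 muln0.
by rewrite exprS size_monicM ?monic_neq0 ?monic_pow // IHk size_f; lia.
Qed.

(** The word f^k * a * 'X^(i - n k) has a as its coefficient of degree i, and is
short enough not to be reduced modulo 'X^N - lambda. *)
Lemma leading_coefs_witness C k a i :
  (forall b, inQ f ^+ k * inQ a%:P * b \in C) -> (n * k <= i < N)%N ->
  a \in leading_coefs C i.
Proof.
move=> Ca /andP[ki iN].
have size_w : (size (f ^+ k * (a%:P * 'X^(i - n * k)))%R <= i.+1)%N.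
  apply: leq_trans (size_polyMleq _ _) _; rewrite size_monic_pow /=.
  apply: leq_trans (leq_add (leqnn _) (size_polyMleq _ _)) _.
  rewrite size_polyXn addnS /= addnCA subnKC // -[leqRHS]add1n leq_add2r.
  exact: size_polyC_leq1.
apply/imsetP; exists (inQ (f ^+ k * (a%:P * 'X^(i - n * k)))).
  rewrite inE in_qpolyK ?size_w ?(leq_trans size_w) // andbT.
  by rewrite mulrA !rmorphM rmorphXn /= Ca.
rewrite in_qpolyK ?(leq_trans size_w) // mulrA coefMXn ltnNge leq_subr /=.
rewrite subKn // coefMC; have := monic_pow k.
by rewrite monicE lead_coefE size_monic_pow => /eqP ->; rewrite mul1r.
Qed.

(** The product f^k a has degree less than N, so it is zero as a polynomial,
and the monic f^k can be cancelled. *)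
Lemma annihilated_short_eq0 k (a : {poly R}) :
  (size a + n * k <= N)%N -> inQ f ^+ k * inQ a = 0 -> a = 0.
Proof.
move=> sa fa0; apply/eqP; apply/negPn/negP => a_neq0.
have fa : f ^+ k * a = 0.
  rewrite -[LHS]in_qpolyK; first by rewrite rmorphM rmorphXn fa0.
  by rewrite size_monicM ?monic_pow // size_monic_pow addSn addnC.
have := size_monicM (monic_pow k) a_neq0.
rewrite fa size_poly0 size_monic_pow; move: a_neq0; rewrite -size_poly_gt0; lia.
Qed.

Section GeneratedCode.
Variables (g : R) (q P nu : nat).
Hypotheses (ann_g : forall x, (g * x == 0) = (x \in principal_ideal g)).
Hypotheses (card_g : #|principal_ideal g| = q) (card_R : #|R| = (q ^ 2)%N).
Hypotheses (NE : N = (n * P)%N) (nu_le : (nu <= 2 * P)%N).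
Hypothesis fP : exists2 u, invertible u & inQ f ^+ P = inQ g%:P * u.
Notation C := (principal_ideal (inQ f ^+ nu)).

Lemma inQ_gE : exists v, inQ g%:P = inQ f ^+ P * v.
Proof. by case: fP => u [v uv ->]; exists v; rewrite -mulrA uv mulr1. Qed.

Lemma inQ_fPP : inQ f ^+ P * inQ f ^+ P = 0.
Proof.
have gg : g * g = 0.
  by apply/eqP; rewrite ann_g; apply/mem_principal_ideal; exists 1; rewrite mul1r.
have inQ_gg : inQ g%:P * inQ g%:P = 0 by rewrite -rmorphM -polyCM gg rmorph0.
by case: fP => u _ ->; rewrite mulrACA inQ_gg mul0r.
Qed.

Lemma inQ_pow_eq0 k : (2 * P <= k)%N -> inQ f ^+ k = 0.
Proof. by move/subnK <-; rewrite mul2n -addnn !exprD inQ_fPP mulr0. Qed.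

Lemma inQ_pow_in_C k w : (nu <= k)%N -> inQ f ^+ k * w \in C.
Proof.
move=> /subnK <-; apply/mem_principal_ideal; exists (inQ f ^+ (k - nu) * w).
by rewrite exprD mulrAC.
Qed.

(** The exponent counts the two thresholds n nu and n (nu - P) that i has
reached: past the second L_i contains gR, past the first it contains 1. *)
Lemma card_leading_coefs i : (i < N)%N ->
  #|leading_coefs C i| = (q ^ ((n * nu <= i) + (n * (nu - P) <= i)))%N.
Proof.
move=> iN; have [v gE] := inQ_gE.
have [nu_i|i_nu] := leqP (n * nu) i.
  have -> : (n * (nu - P) <= i)%N by nia.
  rewrite -card_R -cardsT; apply: eq_card => a; rewrite inE.
  apply: (@leading_coefs_witness _ nu); last by rewrite nu_i.
  by move=> b; rewrite -mulrA inQ_pow_in_C.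
have [t_i|i_t] := leqP (n * (nu - P)) i.
  rewrite -card_g; apply: eq_card => a; apply/idP/idP; last first.
    case/mem_principal_ideal=> r ->.
    apply: (@leading_coefs_witness _ (nu - P)); last by rewrite t_i.
    move=> b; rewrite polyCM rmorphM /= gE.
    have -> : inQ f ^+ (nu - P) * (inQ r%:P * (inQ f ^+ P * v)) * b =
              inQ f ^+ (nu - P + P) * (inQ r%:P * v * b) by rewrite exprD; ring.
    by rewrite inQ_pow_in_C //; lia.
  case/imsetP=> c; rewrite inE => /andP[/mem_principal_ideal[w cE] sc] ->.
  (* By ann_g, membership of the leading coefficient in gR only requires g c = 0;
     f^(P - nu) kills g c, as g is a multiple of f^P, c one of f^nu, and
     f^(2 P) = 0. *)
  suff gc : g *: (c : {poly R}) = 0 by rewrite -ann_g -coefZ gc coef0.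
  apply: (@annihilated_short_eq0 (P - nu)).
    apply: leq_trans (leq_add (size_scale_leq _ _) (leqnn _)) _.
    by rewrite mulnBr -NE; move: (size_codeword c) sc i_nu; lia.
  rewrite -mul_polyC rmorphM /= codewordK cE gE.
  have -> : inQ f ^+ (P - nu) * (inQ f ^+ P * v * (w * inQ f ^+ nu)) =
            inQ f ^+ (P - nu + nu + P) * (v * w) by rewrite !exprD; ring.
  by rewrite inQ_pow_eq0 ?mul0r //; lia.
rewrite expn0 -(cards1 (0 : R)); apply: eq_card => a; rewrite [RHS]inE.
apply/imsetP/eqP => [[c]|->]; last first.
  exists 0; rewrite ?coef0 // inE size_poly0 andbT.
  by apply/mem_principal_ideal; exists 0; rewrite mul0r.
rewrite inE => /andP[/mem_principal_ideal[w cE] sc] ->.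
(* Here nu > P, and c has size at most n (nu - P) = N - n (2 P - nu). *)
suff -> : (c : {poly R}) = 0 by rewrite coef0.
apply: (@annihilated_short_eq0 (2 * P - nu)); first by nia.
by rewrite codewordK cE mulrCA -exprD subnK // inQ_pow_eq0 ?mulr0.
Qed.

Lemma card_words_le r : (r <= N)%N ->
  #|words_le C r| = (q ^ ((r - n * nu) + (r - n * (nu - P))))%N.
Proof.
elim: r => [|r IHr] rN.
  by rewrite card_words_le0 //; case: (principal_ideal_zmod_closed (inQ f ^+ nu)).
rewrite card_words_leS; last exact: principal_ideal_zmod_closed.
rewrite card_leading_coefs // (IHr (ltnW rN)) -expnD; congr (q ^ _)%N.
by case: leqP => ?; case: leqP => ?; lia.
Qed.

End GeneratedCode.
End PowersOfMonic.
End Codewords.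

(** * Weight distribution of the constacyclic codes *)

Theorem theorem3p4 (R : finComNzRingType) (p m n s : nat)
    (gamma zeta alpha0 alpha beta : R) (nu : nat)
    (R_chain : chain_ring R)
    (max_gamma : maximal_ideal (principal_ideal gamma))
    (gamma_neq0 : gamma != 0) (gamma_sq0 : gamma ^+ 2 = 0)
    (p_prime : prime p)
    (residue_card : #|residue_classes (principal_ideal gamma)| = (p ^ m)%N)
    (zeta_order : (p ^ m).-1.-primitive_root zeta)
    (n_gt0 : (0 < n)%N) (s_gt0 : (0 < s)%N) (coprime_np : coprime n p)
    (alpha0_T : alpha0 \in teichmuller zeta (p ^ m))
    (alpha_def : alpha = alpha0 ^+ (p ^ s))
    (alpha_T : alpha \in teichmuller zeta (p ^ m) :\ 0)
    (irr_alpha0 : irreducible_over ('X^n - alpha0%:P))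
    (beta_T : beta \in teichmuller zeta (p ^ m) :\ 0)
    (nu_le : (nu <= 2 * p ^ s)%N) :
  let C : {set constacyclic_ring (n * p ^ s)%N (alpha + gamma * beta)} :=
    principal_ideal (in_qpoly _ ('X^n - alpha0%:P) ^+ nu) in
  [/\ (nu = 2 * p ^ s)%N ->
        forall rho : nat, (rho <= n * p ^ s)%N ->
        rt_number C rho = if rho == 0%N then 1%N else 0%N,
      (p ^ s + 1 <= nu <= 2 * p ^ s - 1)%N ->
        forall rho : nat, (rho <= n * p ^ s)%N ->
        rt_number C rho =
          (if rho == 0 then 1
           else if rho <= n * nu - n * p ^ s then 0
           else (p ^ m - 1) * p ^ (m * (rho + n * p ^ s - n * nu - 1)))%N,
      forall y : nat, (y == 0%N) || (y == 1%N) -> nu = (y * p ^ s)%N ->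
        forall rho : nat, (rho <= n * p ^ s)%N ->
        rt_number C rho =
          (if rho == 0 then 1
           else (p ^ (m * (2 - y)) - 1) * p ^ (m * (2 - y) * (rho - 1)))%N
    & (1 <= nu <= p ^ s - 1)%N ->
        forall rho : nat, (rho <= n * p ^ s)%N ->
        rt_number C rho =
          (if rho == 0 then 1
           else if rho <= n * nu then (p ^ m - 1) * p ^ (m * (rho - 1))
           else (p ^ (2 * m) - 1) * p ^ (m * (2 * rho - n * nu - 2)))%N].
Proof.
have P_gt0 : (0 < p ^ s)%N by rewrite expn_gt0 prime_gt0.
have N_gt0 : (0 < n * p ^ s)%N by rewrite muln_gt0 n_gt0.
have ann := annihilator_gamma max_gamma gamma_neq0 gamma_sq0.
have card_g := card_principal_ideal_gamma max_gamma gamma_neq0 gamma_sq0.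
have card_R := card_ring_gamma max_gamma gamma_neq0 gamma_sq0.
rewrite residue_card in card_g card_R.
(* |R| = p^(2m) is zero in R, so p is nilpotent there. *)
have [c pE] : exists c, p%:R = c * gamma :> R.
  apply/mem_principal_ideal/(@nilp_in_maximal _ _ _ (m * 2)) => //.
  by rewrite -natrX expnM -card_R natr_card_eq0.
have [beta' beta_inv] : invertible beta.
  move: beta_T; rewrite !inE => /andP[/negPf -> /imsetP[i _ ->]].
  exists (zeta ^+ (p ^ m).-2 ^+ i).
  rewrite -exprMn -exprS prednK ?(prim_order_gt0 zeta_order) //.
  by rewrite (prim_expr_order zeta_order) expr1n.
set lambda := alpha + gamma * beta; set f := 'X^n - alpha0%:P.
pose inQ := in_qpoly ('X^(n * p ^ s) - lambda%:P).
(* The binomial lemma applies with F + alpha0 the class of 'X^n. *)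
have fP : exists2 u, invertible u & inQ f ^+ (p ^ s) = inQ gamma%:P * u.
  apply: (@expr_pexp_unit_mul _ p s _ (inQ alpha0%:P) _ (inQ beta%:P) (inQ c%:P)).
  - exact: p_prime.
  - by rewrite /inQ -rmorphM -polyCM -pE polyC_natr rmorph_nat.
  - by rewrite /inQ -rmorphXn -polyC_exp gamma_sq0 rmorph0.
  - by exists (inQ beta'%:P); rewrite /inQ -rmorphM -polyCM beta_inv rmorph1.
  rewrite /inQ -rmorphD subrK -!rmorphXn -exprM /= in_qpoly_Xn //.
  by rewrite -alpha_def -in_qpolyM -in_qpolyD -polyCM -polyCD.
have f_monic : f \is monic by apply: monicXnsubC.
have size_f : size f = n.+1 by apply: size_XnsubC.
move=> C; have zC : zmod_closed C by apply: principal_ideal_zmod_closed.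
have rt0 : rt_number C 0 = 1%N by apply: rt_number0; case: zC.
have rtS r : (r < n * p ^ s)%N -> rt_number C r.+1 =
    ((((p ^ m) ^ ((n * nu <= r) + (n * (nu - p ^ s) <= r))) - 1) *
     (p ^ m) ^ ((r - n * nu) + (r - n * (nu - p ^ s))))%N.
  move=> rN; rewrite rt_numberS //.
  rewrite (card_leading_coefs N_gt0 f_monic size_f ann card_g card_R erefl
    nu_le fP) //.
  by rewrite (card_words_le N_gt0 f_monic size_f ann card_g card_R erefl
    nu_le fP (ltnW rN)).
split.
- move=> nuE [|r] rN //; rewrite rtS //.
  have -> : (n * nu <= r)%N = false by nia.
  have -> : (n * (nu - p ^ s) <= r)%N = false by nia.
  by [].
- move=> nuE [|r] rN //=; rewrite rtS // mulnBr.
  have -> : (n * nu <= r)%N = false by nia.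
  have -> : (r - n * nu = 0)%N by nia.
  case: (leqP (n * nu - n * p ^ s) r) => [le_r|//].
  rewrite expn1 -expnM; congr (_ * p ^ (m * _))%N.
  by have := leq_mul (leqnn n) (_ : p ^ s <= nu)%N; lia.
- move=> y y01 nuE [|r] rN //=; rewrite rtS //.
  have -> : (nu - p ^ s = 0)%N by case/orP: y01 => /eqP yE; nia.
  rewrite muln0 leq0n subn0 -!expnM.
  case/orP: y01 => /eqP yE; rewrite nuE yE ?mul0n ?mul1n ?muln0 ?subn0.
    by rewrite leq0n; congr ((p ^ _ - 1) * p ^ _)%N; lia.
  rewrite leqNgt rN /=; congr ((p ^ _ - 1) * p ^ _)%N; lia.
move=> nuE [|r] rN //=; rewrite rtS //.
have -> : (nu - p ^ s = 0)%N by lia.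
rewrite muln0 leq0n subn0 -!expnM.
case: (leqP (n * nu) r) => [le_r|lt_r]; congr ((p ^ _ - 1) * p ^ _)%N; nia.
Qed.
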